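(* Let $t\ge -1$ be an integer, let $\theta$ be a root of $P_t(x)=x^3-tx^2-(t+3)x-1$ and $K=\mathbb{Q}(\theta)$ (a simplest cubic field). Suppose that $\mathcal{O}_K=\mathbb{Z}[\theta]$. Then $K$ is unit reducible.
   Context: For a totally real number field $K$ with ring of integers $\mathcal{O}_K$ and unit group $\mathcal{O}_K^\times$, let $K_{>>0}$ be the set of totally positive elements and, for $a\in K_{>>0}$, $\mu(a)=\min_{x\in\mathcal{O}_K\setminus\{0\}}\mathrm{Tr}_{K/\mathbb{Q}}(ax^2)$. $K$ is called unit reducible if $\mu(a)=\min_{u\in\mathcal{O}_K^\times}\mathrm{Tr}_{K/\mathbb{Q}}(au^2)$ for all $a\in K_{>>0}$. *)

(* Defs.v *)
From HB Require Import structures.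
From mathcomp Require Import all_boot all_order all_algebra all_field.
Set Implicit Arguments. Unset Strict Implicit. Unset Printing Implicit Defensive.
Import Order.TTheory GRing.Theory Num.Theory.
Local Open Scope ring_scope.

Definition simplest_cubic (t : int) : {poly rat} :=
  'X^3 - (t%:~R)%:P * 'X^2 - ((t + 3)%:~R)%:P * 'X - 1.

Section NumberField.
Variable K : fieldExtType rat.

Definition fieldTrace (x : K) : rat :=
  \tr (passmx.mxof (vbasis {:K}) (vbasis {:K}) (amull x)).

Definition isAlgInt (x : K) : Prop :=
  exists p : {poly int}, p \is monic /\ root (map_poly intr p) x.

Definition inOK (x : K) : Prop := isAlgInt x.
Definition isUnitOK (u : K) : Prop := inOK u /\ exists v, inOK v /\ u * v = 1.

Definition inZadj (theta x : K) : Prop :=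
  exists q : {poly int}, x = (map_poly intr q).[theta].

Definition totally_positive (a : K) : Prop :=
  forall sigma : {rmorphism K -> algC}, 0 < sigma a.

Definition is_min (S : rat -> Prop) (m : rat) : Prop :=
  S m /\ forall s, S s -> m <= s.

Definition unit_reducible : Prop :=
  forall a : K, totally_positive a ->
    exists m : rat,
      is_min (fun s => exists x, inOK x /\ x != 0 /\ s = fieldTrace (a * x ^+ 2)) m /\
      is_min (fun s => exists u, isUnitOK u /\ s = fieldTrace (a * u ^+ 2)) m.

End NumberField.

(* Main.v *)
Require Import Defs.
From HB Require Import structures.
From mathcomp Require Import all_boot all_order all_algebra all_field.
From mathcomp Require Import spectral ring lra zify.
From Stdlib Require Import Classical_Prop.

(** Let theta, theta', theta'' be the conjugates of theta, cyclically ordered so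
    that theta * theta' = - 1 - theta'; they are units, as are the elements
    1 + theta_i, and (1, theta, theta') is a basis of Z[theta]. The form
    x |-> Tr (b x^2) depends only on N = Tr b and on b_i = Tr (b theta_i), where
    b_1 + b_2 + b_3 = t N. Choose a unit u minimising Tr (a u^2) and put
    b = a u^2. Comparing Tr b with Tr (b e^2) for e = theta_i and
    e = 1 + theta_i puts (b_i / N) in a hexagon, whose vertices are the cyclic
    permutations of (0, -1, t + 1) and of (-1/2, (t - 1)/2, (t + 2)/2). At the
    first three vertices the form is integrally equivalent to a sum of three
    squares, and at the other three its minimum is also 1. Every form in the
    hexagon is a convex combination of vertex forms, so it is at least N on the
    nonzero elements of Z[theta]. *)

Set Implicit Arguments. Unset Strict Implicit. Unset Printing Implicit Defensive.
Import Order.TTheory GRing.Theory Num.Theory.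
Local Open Scope ring_scope.

(** * Ternary forms over the hexagon *)

(* The value of Tr (b v^2) at v = x + y theta + z theta', where N, b, c stand for
   Tr b, Tr (b theta), Tr (b theta'). *)
Definition qform (R : comNzRingType) (t N b c x y z : R) : R :=
  x ^+ 2 * N + y ^+ 2 * (2 * N + (t + 1) * b + c) +
  z ^+ 2 * (2 * N + (t + 1) * c + (t * N - b - c)) +
  2 * x * y * b + 2 * x * z * c - 2 * y * z * (N + c).

(* [excess] is negative exactly beyond the side joining (0, -1, t + 1) to
   (-1, t + 1, 0) of the triangle of "sum of three squares" vertices. *)
Definition excess (R : comNzRingType) (t N b c : R) : R :=
  N + (t + 2) * b + c.

(* Rewrites the form in the basis (1, theta', theta''). *)
Lemma qform_rot (R : comNzRingType) (t N b c x y z : R) :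
  qform t N b c x y z =
  qform t N c (t * N - b - c) (x + t * y) (z - y) (- y).
Proof. rewrite /qform; ring. Qed.

(** Each [excess] vanishes at two of the three vertices and equals [t ^+ 2 + 3 * t + 3] at the
    third, so the three are scaled barycentric coordinates. *)
Lemma qform_cubes (R : comNzRingType) (t N b c x y z : R) (d := t * N - b - c) :
  (t ^+ 2 + 3 * t + 3) * qform t N b c x y z =
  excess t N b c * qform t 1 (t + 1) 0 x y z +
  excess t N c d * qform t 1 (- 1) (t + 1) x y z +
  excess t N d b * qform t 1 0 (- 1) x y z.
Proof. rewrite /d /excess /qform; ring. Qed.

Lemma excess_sum (R : comNzRingType) (t N b c : R) (d := t * N - b - c) :
  excess t N b c + excess t N c d + excess t N d b =
  (t ^+ 2 + 3 * t + 3) * N.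
Proof. rewrite /d /excess; ring. Qed.

(* The last form is twice the one at the vertex (-1/2, (t - 1)/2, (t + 2)/2). *)
Lemma qform_hex (R : comNzRingType) (t N b c x y z : R) (f := excess t N b c) :
  qform t N b c x y z =
  (N + b + f) * qform t 1 0 (- 1) x y z +
  (f - b) * qform t 1 (- 1) (t + 1) x y z -
  f * qform t 2 (- 1) (t - 1) x y z.
Proof. rewrite /f /excess /qform; ring. Qed.

Lemma qform_intr (R : comNzRingType) (t N b c x y z : int) :
  (qform t N b c x y z)%:~R =
  qform t%:~R N%:~R b%:~R c%:~R x%:~R y%:~R z%:~R :> R.
Proof. by rewrite /qform; ring. Qed.

Lemma sumsq3_ge1 (x y z : int) : (x, y, z) != 0 ->
  1 <= x ^+ 2 + y ^+ 2 + z ^+ 2.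
Proof.
move=> h; have: 0 < x ^+ 2 + y ^+ 2 + z ^+ 2; last by lia.
rewrite lt_def !addr_ge0 ?sqr_ge0 // andbT.
apply: contra h; rewrite !paddr_eq0 ?addr_ge0 ?sqr_ge0 // !sqrf_eq0.
by case/andP=> /andP[/eqP-> /eqP->] /eqP->.
Qed.

Lemma qform_cube1_ge1 (t x y z : int) : (x, y, z) != 0 ->
  1 <= qform t 1 0 (- 1) x y z.
Proof.
move=> h; rewrite (_ : qform _ _ _ _ _ _ _ = (x - z) ^+ 2 + y ^+ 2 + z ^+ 2).
  apply: sumsq3_ge1; apply: contra h => /eqP[*]; apply/eqP; congr (_, _, _); lia.
rewrite /qform; ring.
Qed.

Lemma qform_cube2_ge1 (t x y z : int) : (x, y, z) != 0 ->
  1 <= qform t 1 (t + 1) 0 x y z.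
Proof.
move=> h; rewrite (_ : qform _ _ _ _ _ _ _ =
  (x + (t + 1) * y) ^+ 2 + y ^+ 2 + (z - y) ^+ 2).
  apply: sumsq3_ge1; apply: contra h => /eqP[h1 h2 h3]; subst y.
  apply/eqP; congr (_, _, _); lia.
rewrite /qform; ring.
Qed.

Lemma qform_cube3_ge1 (t x y z : int) : (x, y, z) != 0 ->
  1 <= qform t 1 (- 1) (t + 1) x y z.
Proof.
move=> h; rewrite (_ : qform _ _ _ _ _ _ _ =
  (x - y + (t + 1) * z) ^+ 2 + (y - z) ^+ 2 + z ^+ 2).
  apply: sumsq3_ge1; apply: contra h => /eqP[h1 h2 h3]; subst z.
  apply/eqP; congr (_, _, _); lia.
rewrite /qform; ring.
Qed.

Lemma qform_hex_ge2 (t x y z : int) : -1 <= t -> (x, y, z) != 0 ->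
  2 <= qform t 2 (- 1) (t - 1) x y z.
Proof.
move=> t_ge h; have [z0|z0] := eqVneq z 0.
  (* On this plane the form is [2 * (x ^+ 2 - x * y + y ^+ 2)], which is even and positive. *)
  have : 1 <= x ^+ 2 + y ^+ 2 + z ^+ 2 by apply: sumsq3_ge1.
  subst z; rewrite /qform; nia.
(* Completing squares in x, then y, leaves at least 14 > 6 * 2 from the [z ^+ 2] term when
   [-1 <= t]. *)
have E : 6 * qform t 2 (- 1) (t - 1) x y z = 3 * (2 * x - y + (t - 1) * z) ^+ 2 +
    (3 * y - (t + 3) * z) ^+ 2 + (2 * t ^+ 2 + 6 * t + 18) * z ^+ 2.
  by rewrite /qform; ring.
have z1 : 1 <= z ^+ 2 by nia.
have tz : 14 <= (2 * t ^+ 2 + 6 * t + 18) * z ^+ 2.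
  have : 14 <= 2 * t ^+ 2 + 6 * t + 18 by nia.
  nia.
have := sqr_ge0 (2 * x - y + (t - 1) * z).
have := sqr_ge0 (3 * y - (t + 3) * z).
lia.
Qed.

Section Min.
Variables (R : realFieldType) (t : int).
Hypothesis t_ge : -1 <= t.

(** The sign conditions describe the corner of the hexagon beyond one side of the triangle. They
    make the weights of [qform_hex] nonnegative, and against the bounds 1, 1, 2 these weights add up
    to [N]. *)
Lemma qform_min_hex (N b c : R) (x y z : int) (f := excess t%:~R N b c) :
  (x, y, z) != 0 -> 0 <= f - b -> 0 <= N + b + f -> f <= 0 ->
  N <= qform t%:~R N b c x%:~R y%:~R z%:~R.
Proof.
move=> h h1 h2 h3; rewrite qform_hex -/f.
have q1 : 1 <= qform t%:~R 1 0 (- 1) x%:~R y%:~R z%:~R :> R.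
  by have := qform_cube1_ge1 t h; rewrite -(ler_int R) qform_intr.
have q2 : 1 <= qform t%:~R 1 (- 1) (t%:~R + 1) x%:~R y%:~R z%:~R :> R.
  by have := qform_cube3_ge1 t h; rewrite -(ler_int R) qform_intr !intrD.
have q3 : 2 <= qform t%:~R 2 (- 1) (t%:~R - 1) x%:~R y%:~R z%:~R :> R.
  by have := qform_hex_ge2 t_ge h; rewrite -(ler_int R) qform_intr !intrD.
have := ler_wpM2l h2 q1; have := ler_wpM2l h1 q2.
have := @ler_wpM2l _ (- f) _ _ _ q3; rewrite oppr_ge0 => /(_ h3).
lra.
Qed.

(** The hypothesis lists the six sides of the hexagon. A negative excess puts the point in a corner,
    which a rotation brings to [qform_min_hex]; otherwise the point is in the triangle and
    [qform_cubes] applies. *)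
Lemma qform_min (N b c : R) (d := t%:~R * N - b - c) (x y z : int) :
  (x, y, z) != 0 ->
  (forall b' c', (b', c') \in [:: (b, c); (c, d); (d, b)] ->
    0 <= excess t%:~R N b' c' - b' /\ 0 <= N + b' + excess t%:~R N b' c') ->
  N <= qform t%:~R N b c x%:~R y%:~R z%:~R.
Proof.
move=> h H.
have [f1|/ltW f1] := leP 0 (excess t%:~R N b c); last first.
  by have [] := H b c; rewrite ?inE ?eqxx // => *; apply: qform_min_hex.
have rot_neq0 (u v w : int) : (u, v, w) != 0 -> (u + t * v, w - v, - v) != 0.
  apply: contra => /eqP[] h1 h2 h3; have v0 : v = 0 by lia.
  by subst v; apply/eqP; congr (_, _, _); lia.
have [f2|/ltW f2] := leP 0 (excess t%:~R N c d); last first.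
  have [|h1 h2] := H c d; first by rewrite ?inE ?eqxx ?orbT.
  rewrite qform_rot -intrM -!(intrD,rmorphN).
  by apply: qform_min_hex => //; apply: rot_neq0.
have [f3|/ltW f3] := leP 0 (excess t%:~R N d b); last first.
  have [|h1 h2] := H d b; first by rewrite ?inE ?eqxx ?orbT.
  rewrite qform_rot -/d qform_rot (_ : _ - c - d = b); last by rewrite /d; ring.
  rewrite -?(intrM, intrD, rmorphN) /=.
  by apply: qform_min_hex => //; exact/rot_neq0/rot_neq0.
have D0 : 0 < t%:~R ^+ 2 + 3 * t%:~R + 3 :> R.
  have : 0 < t ^+ 2 + 3 * t + 3 by have := sqr_ge0 (2 * t + 3); lia.
  by rewrite -(ltr_int R) !(intrD, intrM, rmorphXn).
rewrite -(ler_pM2l D0) qform_cubes -(excess_sum _ _ b c) -/d.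
rewrite !lerD // -[X in X <= _]mulr1 ler_wpM2l //.
- by have := qform_cube2_ge1 t h; rewrite -(ler_int R) qform_intr intrD.
- by have := qform_cube3_ge1 t h; rewrite -(ler_int R) qform_intr !intrD.
- by have := qform_cube1_ge1 t h; rewrite -(ler_int R) qform_intr.
Qed.
End Min.

(** * The trace as a sum of complex embeddings *)

Lemma trig_mulmx_diag (R : nzRingType) n (A B : 'M[R]_n) i :
  is_trig_mx A -> is_trig_mx B -> (A *m B) i i = A i i * B i i.
Proof.
move=> /is_trig_mxP At /is_trig_mxP Bt; rewrite mxE (bigD1 i) //= big1 ?addr0 //.
move=> j; rewrite neq_ltn => /orP[lt|lt]; last by rewrite At ?mul0r.
by rewrite Bt ?mulr0.
Qed.

Section Trace.
Variable K : fieldExtType rat.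
Let e := vbasis {:K}.

(* A simultaneous triangularisation of the multiplication matrices has ring
   morphisms as diagonal entries. *)
Lemma trace_embeddings : exists n (sigma : 'I_n -> {rmorphism K -> algC}),
  forall x, ratr (fieldTrace x) = \sum_i sigma i x.
Proof.
have eb : basis_of {:K} e by apply: vbasisP.
pose M x : 'M[algC]_(\dim {:K}) := map_mx ratr (passmx.mxof e e (amull x)).
have MP a x y : M (a *: x + y) = ratr a *: M x + M y.
  by rewrite /M linearP (passmx.mxof_linear e e) map_mxD map_mxZ.
have MM x y : M (x * y) = M x *m M y.
  by rewrite /M mulrC amullM (passmx.mxof_comp _ _ eb) map_mxM.
have M1 : M 1 = 1%:M.
  rewrite /M amull1 -(map_mx1 (ratr : {rmorphism rat -> algC})); congr map_mx.
  apply/row_matrixP => i; rewrite !rowE passmx.mul_mxof mulmx1 id_lfunE.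
  by rewrite passmx.vecofK.
(* The matrices commute because K does. Only those of the basis are triangularised here; [Ctrig]
   extends this by linearity. *)
have [|P Pu /allP Pt] := @cotrigonalization algC _ [seq M x | x <- e].
  by move=> _ _ /mapP[x _ ->] /mapP[y _ ->]; rewrite /comm_mx -!MM mulrC.
have Punit := unitarymx_unit Pu.
pose C x := conjmx P (M x).
have CE x : C x = P *m M x *m invmx P by rewrite /C conjumx.
have CP a x y : C (a *: x + y) = ratr a *: C x + C y.
  by rewrite !CE MP mulmxDr mulmxDl -scalemxAr -scalemxAl.
have CM x y : C (x * y) = C x *m C y by rewrite !CE MM !mulmxA mulmxKV.
have C1 : C 1 = 1%:M by rewrite CE M1 mulmx1 mulmxV.
have C0 : C 0 = 0.
  by have := CP (- 1) 0 0; rewrite scaler0 addr0 rmorphN1 scaleN1r addNr.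
have Ce i : is_trig_mx (C e`_i).
  have [i_lt|i_ge] := ltnP i (size e); first by apply/Pt/map_f/mem_nth.
  by rewrite nth_default // C0 mx0_is_trig.
have Ctr x : \tr (C x) = ratr (fieldTrace x).
  rewrite CE mxtrace_mulC mulmxA mulVmx // mul1mx.
  exact: (trace_map_mx (ratr : {rmorphism rat -> algC})).
clearbody C.
have Ctrig x : is_trig_mx (C x).
  rewrite (coord_basis eb (memvf x)).
  elim/big_rec: _ => [|i y _ IH]; first by rewrite C0 mx0_is_trig.
  rewrite CP; apply/is_trig_mxP => j k jk.
  by rewrite !mxE (is_trig_mxP IH) // (is_trig_mxP (Ce i)) // mulr0 addr0.
pose s i x := C x i i.
have sB i : zmod_morphism (s i).
  move=> x y; rewrite /s addrC -scaleN1r CP !mxE rmorphN1 mulN1r.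
  exact: addrC.
have sM i : monoid_morphism (s i).
  split=> [|x y]; rewrite /s; first by rewrite C1 mxE eqxx.
  by rewrite CM trig_mulmx_diag.
pose sig i : {rmorphism K -> algC} :=
  HB.pack (s i) (GRing.isZmodMorphism.Build _ _ _ (sB i))
                (GRing.isMonoidMorphism.Build _ _ _ (sM i)).
by exists _, sig => x; rewrite -Ctr.
Qed.
End Trace.

(** * Existence of minima and total reality *)

Lemma nat_min_exists (P : nat -> Prop) : (exists n, P n) ->
  exists2 n, P n & forall k, P k -> (n <= k)%N.
Proof.
case=> n; elim/ltn_ind: n => n IH Pn.
have [[k [Pk lt_kn]]|none] := classic (exists k, P k /\ (k < n)%N).
  exact: IH lt_kn Pk.
exists n => // k Pk; rewrite leqNgt; apply/negP => lt_kn.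
by apply: none; exists k.
Qed.

(** A common denominator [d] turns the set into one of natural numbers, where well-ordering
    applies. *)
Lemma rat_min_exists (S : rat -> Prop) (d : rat) : 0 < d -> (exists s, S s) ->
  (forall s, S s -> 0 <= s /\ s * d \is a Num.int) -> exists m, is_min S m.
Proof.
move=> d0 [s0 Ss0] H.
have toN s : S s -> exists n, s = n%:R / d.
  case/H=> s_ge0 /intrP[i ids]; exists `|i|%N.
  have i_ge0 : 0 <= i by rewrite -(ler_int rat) -ids mulr_ge0 // ltW.
  by rewrite pmulrn gez0_abs // -ids mulfK ?gt_eqF.
have [|n Sn n_min] := @nat_min_exists (fun n => S (n%:R / d)).
  by have [n E] := toN _ Ss0; exists n; rewrite -E.
exists (n%:R / d); split=> // s Ss; have [k E] := toN _ Ss.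
by rewrite E ler_pM2r ?invr_gt0 // ler_nat; apply: n_min; rewrite -E.
Qed.

(* Complex conjugation commutes with the cyclic permutation [rot] of the three
   roots, so it is a power of it, and an involution: it is the identity. *)
Lemma simplest_cubic_root_real (t r : algC) : t \is Num.real ->
  r ^+ 3 - t * r ^+ 2 - (t + 3) * r - 1 = 0 -> r \is Num.real.
Proof.
move=> treal r0.
have conj_root : (r^*) ^+ 3 - t * (r^*) ^+ 2 - (t + 3) * r^* - 1 = 0.
  have := congr1 Num.conj r0.
  rewrite !(rmorphB, rmorphD, rmorphM, rmorphXn, rmorph1, rmorph0) /=.
  by rewrite (conj_Creal treal).
pose P (z : algC) := z ^+ 3 - t * z ^+ 2 - (t + 3) * z - 1.
(* On the roots of [P] this equals - 1 / (1 + z), a map of order three. *)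
pose rot (z : algC) := z ^+ 2 - (t + 1) * z - 2.
have conj_rot z : (rot z)^* = rot z^*.
  rewrite /rot !(rmorphB, rmorphD, rmorphM, rmorphXn, rmorph1, rmorph_nat) /=.
  by rewrite (conj_Creal treal).
have factor w : P w = (w - r) * (w - rot r) * (w - (t - r - rot r)).
  rewrite -[RHS]addr0 -(mul0r (w * (r - t - 1) - rot r - 1)) -r0 /P /rot; ring.
have rotrot z : P z = 0 -> rot (rot z) = t - z - rot z.
  move=> z0; rewrite -[RHS]addr0 -(mul0r (z - t - 2)) -z0 /P /rot; ring.
have rot_root : P (rot r) = 0 by rewrite factor subrr mulr0 mul0r.
have rot3 : rot (t - r - rot r) = r.
  by rewrite -(rotrot r) // (rotrot (rot r)) // (rotrot r) //; ring.
move/eqP: conj_root; rewrite -/(P _) factor !mulf_eq0 !subr_eq0.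
case/orP => [/orP[|]|] /eqP E.
- exact/CrealP.
- have E1 : t - r - rot r = r by rewrite -rotrot // -E -conj_rot -E conjCK.
  by apply/CrealP; rewrite E -[RHS]rot3 E1.
- have E1 : rot r = r^* by rewrite -[LHS]conjCK conj_rot E rot3.
  by apply/CrealP; rewrite E -rotrot // E1 E rot3.
Qed.

Lemma qform_den (N b c : rat) : exists2 d : rat, 0 < d &
  forall t x y z : int,
    qform t%:~R N b c x%:~R y%:~R z%:~R * d \is a Num.int.
Proof.
exists (denq N * denq b * denq c)%:~R.
  by rewrite ltr0z !mulr_gt0 ?denq_gt0.
move=> t x y z.
rewrite (_ : _ * _ = (qform t (numq N * denq b * denq c)
  (numq b * denq N * denq c) (numq c * denq N * denq b) x y z)%:~R) ?intr_int //.
by rewrite qform_intr !intrM !numqE /qform; ring.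
Qed.

(** * Arithmetic of Z[theta] and minimisation over units *)

Section SimplestCubic.
Variables (t : int) (K : fieldExtType rat) (theta : K).
Hypothesis theta_root : root (map_poly (in_alg K) (simplest_cubic t)) theta.
Hypothesis OK_theta : forall x : K, inOK x <-> inZadj theta x.

Let theta' := theta ^+ 2 - (t%:~R + 1) * theta - 2.
Let elt (x y z : int) : K := x%:~R + y%:~R * theta + z%:~R * theta'.

(* theta, 1 + theta, theta', 1 + theta', theta'', 1 + theta'', where
   theta'' = t - theta - theta'. *)
Let nbrs : seq (int * int * int) :=
  [:: (0, 1, 0); (1, 1, 0); (0, 0, 1); (1, 0, 1); (t, -1, -1); (t + 1, -1, -1)].

Lemma theta_eq0 :
  theta ^+ 3 - t%:~R * theta ^+ 2 - (t%:~R + 3) * theta - 1 = 0.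
Proof.
move: theta_root; rewrite /root /simplest_cubic => /eqP <-.
rewrite 3!rmorphB rmorph1 /= map_polyXn rmorphM /= map_polyXn.
rewrite rmorphM /= map_polyX !map_polyC /=.
by rewrite !(hornerD, hornerN, hornerM, hornerXn, hornerX, hornerC)
  !scaler_int intrD.
Qed.

Lemma inOK_mul (x y : K) : inOK x -> inOK y -> inOK (x * y).
Proof.
move=> /OK_theta[p ->] /OK_theta[q ->]; apply/OK_theta.
by exists (p * q); rewrite rmorphM hornerM.
Qed.

Lemma inOK_elt (x y z : int) : inOK (elt x y z).
Proof.
apply/OK_theta.
exists (x%:P + y%:P * 'X + z%:P * ('X ^+ 2 - (t%:P + 1) * 'X - 2%:P)).
rewrite !(rmorphB, rmorphD, rmorphM, rmorph1) /=.
rewrite !(hornerD, hornerN, hornerM, hornerXn, hornerX, hornerC).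
by rewrite !map_polyC map_polyX /= !hornerC hornerX /elt /theta' expr2.
Qed.

Lemma inOK_coord (x : K) : inOK x -> exists c : int * int * int,
  x = elt c.1.1 c.1.2 c.2.
Proof.
move=> /OK_theta[p ->]; elim/poly_ind: p => [|p a [[[x0 y0] z0] /= IH]].
  by exists (0, 0, 0); rewrite rmorph0 horner0 /elt /=; ring.
(* Horner step: [theta ^+ 2 = theta' + (t + 1) * theta + 2] and [theta * theta' = - 1 - theta']. *)
exists (a + 2 * y0 - z0, x0 + (t + 1) * y0, y0 - z0) => /=.
rewrite rmorphD rmorphM /= map_polyX map_polyC hornerD hornerMX hornerC IH.
rewrite -[RHS](addr0) -(mulr0 z0%:~R) -theta_eq0 /elt /theta'; ring.
Qed.

Lemma fieldTraceP (a : rat) (x y : K) :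
  fieldTrace (a *: x + y) = a * fieldTrace x + fieldTrace y.
Proof.
by rewrite /fieldTrace linearP passmx.mxof_linear mxtraceD mxtraceZ.
Qed.

Lemma fieldTrace0 : fieldTrace (0 : K) = 0.
Proof. by have := fieldTraceP (- 1) 0 0; rewrite scaler0 addr0 mulN1r addNr. Qed.

Lemma fieldTrace_elt (a : K) (x y z : int) :
  fieldTrace (a * elt x y z ^+ 2) =
  qform t%:~R (fieldTrace a) (fieldTrace (a * theta)) (fieldTrace (a * theta'))
    x%:~R y%:~R z%:~R.
Proof.
(* Coordinates of [elt x y z ^+ 2] in 1, theta, theta'. *)
pose A := x ^+ 2 + 2 * y ^+ 2 + (t + 2) * z ^+ 2 - 2 * y * z.
pose B := (t + 1) * y ^+ 2 - z ^+ 2 + 2 * x * y.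
pose C := y ^+ 2 + t * z ^+ 2 + 2 * x * z - 2 * y * z.
have scale_int (k : int) (w : K) : k%:~R *: w = k%:~R * w.
  by rewrite scaler_int mulrzl.
have -> : a * elt x y z ^+ 2 = A%:~R *: a + (B%:~R *: (a * theta) +
    (C%:~R *: (a * theta') + 0)).
  rewrite !scale_int addr0; apply/eqP; rewrite -subr_eq0; apply/eqP.
  rewrite -(mul0r (a * (2 * y%:~R * z%:~R + z%:~R ^+ 2 * (theta - t%:~R - 2)))).
  by rewrite -theta_eq0 /A /B /C /elt /theta'; ring.
by rewrite !fieldTraceP fieldTrace0 /A /B /C /qform; ring.
Qed.

(** Every embedding sends theta, hence x, to a real number, so each term of the trace is
    nonnegative. *)
Lemma fieldTrace_sq_ge0 (a x : K) : totally_positive a -> inOK x ->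
  0 <= fieldTrace (a * x ^+ 2).
Proof.
move=> a_gt0 /inOK_coord[c ->].
have [n [sigma trE]] := trace_embeddings K.
rewrite -(ler0q algC) trE sumr_ge0 // => i _.
rewrite rmorphM rmorphXn mulr_ge0 ?(ltW (a_gt0 _)) // real_exprn_even_ge0 //.
have th_real : sigma i theta \is Num.real.
  apply: (@simplest_cubic_root_real t%:~R); first exact: realz.
  have := congr1 (sigma i) theta_eq0.
  by rewrite !(rmorphB, rmorphD, rmorphM, rmorphXn, rmorph1, rmorph0,
    rmorph_int, rmorph_nat).
rewrite /elt /theta' !(rmorphB, rmorphD, rmorphM, rmorphXn, rmorph1,
  rmorph_int, rmorph_nat).
by rewrite !(rpredB, rpredD, rpredM, rpredX, rpred1, rpred_nat, realz).
Qed.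

Lemma isUnitOK_mul (u v : K) : isUnitOK u -> isUnitOK v -> isUnitOK (u * v).
Proof.
move=> [Ou [u' [Ou' uu']]] [Ov [v' [Ov' vv']]]; split; first exact: inOK_mul.
by exists (u' * v'); split; [exact: inOK_mul | rewrite mulrACA uu' vv' mulr1].
Qed.

Lemma isUnitOK_pair (u v : K) : inOK u -> inOK v -> u * v = -1 ->
  isUnitOK u /\ isUnitOK v.
Proof.
have OKN (w : K) : inOK w -> inOK (- w).
  have -> : - w = elt (-1) 0 0 * w by rewrite /elt; ring.
  exact/inOK_mul/inOK_elt.
move=> Ou Ov uv; split; split=> //.
  by exists (- v); split; [exact: OKN | rewrite mulrN uv opprK].
by exists (- u); split; [exact: OKN | rewrite mulrN mulrC uv opprK].
Qed.

(** The six elements pair off with product -1: each theta_i times 1 plus the preceding conjugate. *)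
Lemma unit_elt : {in nbrs, forall c, isUnitOK (elt c.1.1 c.1.2 c.2)}.
Proof.
have [U1 U6] : isUnitOK (elt 0 1 0) /\ isUnitOK (elt (t + 1) (-1) (-1)).
  apply: isUnitOK_pair; try exact: inOK_elt.
  rewrite -[RHS]subr0 -theta_eq0 /elt /theta'; ring.
have [U2 U3] : isUnitOK (elt 1 1 0) /\ isUnitOK (elt 0 0 1).
  apply: isUnitOK_pair; try exact: inOK_elt.
  rewrite -[RHS]addr0 -theta_eq0 /elt /theta'; ring.
have [U4 U5] : isUnitOK (elt 1 0 1) /\ isUnitOK (elt t (-1) (-1)).
  apply: isUnitOK_pair; try exact: inOK_elt.
  rewrite -[RHS]addr0 -(mul0r (t%:~R + 1 - theta)) -theta_eq0 /elt /theta'; ring.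
by move=> c; rewrite !inE; do ![case/orP=> [/eqP-> //|]] => /eqP->.
Qed.

(** Comparison with theta_i gives [0 <= excess - b_i], and with 1 + theta_i gives
    [0 <= N + b_i + excess]: the sides required by [qform_min]. *)
Lemma fieldTrace_min1 (b x : K) : -1 <= t ->
  (forall u, isUnitOK u -> fieldTrace b <= fieldTrace (b * u ^+ 2)) ->
  inOK x -> x != 0 -> fieldTrace b <= fieldTrace (b * x ^+ 2).
Proof.
move=> t_ge bmin /inOK_coord[[[x0 y0] z0] /= ->] x_neq0.
rewrite fieldTrace_elt; apply: qform_min => //.
  apply: contra x_neq0 => /eqP[-> -> ->]; apply/eqP; rewrite /elt; ring.
have H c : c \in nbrs ->
    fieldTrace b <= qform t%:~R (fieldTrace b) (fieldTrace (b * theta))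
      (fieldTrace (b * theta')) c.1.1%:~R c.1.2%:~R c.2%:~R.
  by move=> /unit_elt /bmin; rewrite fieldTrace_elt.
move: H; set N := fieldTrace b; set B := fieldTrace _; set C := fieldTrace _ => H.
have h1 := H (0, 1, 0) isT; have h2 := H (1, 1, 0) isT.
have h3 := H (0, 0, 1) isT; have h4 := H (1, 0, 1) isT.
have /H h5 : (t, -1, -1) \in nbrs by rewrite !inE eqxx !orbT.
have /H h6 : (t + 1, -1, -1) \in nbrs by rewrite !inE eqxx !orbT.
move: {H} h1 h2 h3 h4 h5 h6; rewrite /qform /= !intrD => h1 h2 h3 h4 h5 h6.
move=> b' c'; rewrite !inE /excess => /or3P[]/eqP[-> ->]; split.
- by move: h1; clear; lra.
- by move: h2; clear; lra.
- by move: h3; clear; lra.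
- by move: h4; clear; lra.
- by move: h5; clear; lra.
- by move: h6; clear; lra.
Qed.

Lemma simplest_cubic_unit_reducible : -1 <= t -> unit_reducible K.
Proof.
move=> t_ge a a_gt0.
have [d d_gt0 dP] := qform_den (fieldTrace a) (fieldTrace (a * theta))
  (fieldTrace (a * theta')).
have OK1 : inOK (1 : K).
  by have := inOK_elt 1 0 0; rewrite /elt !mul0r !addr0.
have unit1 : isUnitOK (1 : K) by split=> //; exists 1; rewrite mulr1.
have [||m m_min] := @rat_min_exists
  (fun s => exists u, isUnitOK u /\ s = fieldTrace (a * u ^+ 2)) d d_gt0.
- by exists (fieldTrace (a * 1 ^+ 2)), 1.
- move=> _ [u [[Ou _] ->]]; split; first exact: fieldTrace_sq_ge0.
  by have [c ->] := inOK_coord Ou; rewrite fieldTrace_elt.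
exists m; split=> //; case: m_min => [[u [Uu ->]] u_min].
have [Ou [v [Ov uv]]] := Uu; split.
  exists u; split=> //; split=> //; apply/eqP => u0.
  by move/eqP: uv; rewrite u0 mul0r eq_sym oner_eq0.
move=> _ [x [Ox [x_neq0 ->]]].
(* This moves the minimising unit [u] into the form: among units, [a * u ^+ 2] attains its least
   value at 1. *)
have xE : x = u * (v * x) by rewrite mulrA uv mul1r.
have -> : a * x ^+ 2 = (a * u ^+ 2) * (v * x) ^+ 2.
  by rewrite {1}xE exprMn mulrA.
apply: (@fieldTrace_min1 (a * u ^+ 2) (v * x) t_ge).
- move=> w Uw; rewrite -mulrA -exprMn; apply: u_min.
  by exists (u * w); split=> //; apply: isUnitOK_mul.
- exact: inOK_mul.
- by apply: contra x_neq0 => /eqP vx0; rewrite xE vx0 mulr0.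
Qed.
End SimplestCubic.

(* K = Q(theta) with theta a root of P_t, t >= -1, and O_K = Z[theta]. *)
Theorem theorem5 (t : int) (K : fieldExtType rat) (theta : K) :
  (-1 <= t)%R ->
  root (map_poly (in_alg K) (simplest_cubic t)) theta ->
  <<1; theta>>%VS = fullv ->
  (forall x : K, inOK x <-> inZadj theta x) ->
  unit_reducible K.
Proof.
by move=> t_ge theta_root _ OKE; apply: simplest_cubic_unit_reducible OKE t_ge.
Qed.
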